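(* Let $\mathsf{V}_o$ be a finite set of vertices, let $\mathsf{U}_o$ be the finite-dimensional real vector space of functions $\mathsf{V}_o\to\mathbb{R}^{d_u}$, let $\mathsf{Z}=\mathbb{R}^{d_z}$, and let $D_o^\psi:\mathsf{Z}\to\mathsf{U}_o$ be a (Borel) measurable map. Let $q_{\mathbf{z}}=\mathcal{N}(\mathbf{0},\mathbf{I})$ be the standard Gaussian on $\mathsf{Z}$, let $p_{\sigma_o}$ be a prior probability distribution on $(0,\infty)$ for the noise standard deviation $\sigma_o$, let $\mathbf{H}_o:\mathsf{U}_o\to\mathbb{R}^{d_o}$ be the linear observation operator (a matrix of zeros and ones selecting the observed nodal values), and let $\mathbf{y}_o\in\mathbb{R}^{d_o}$. Let $p^\psi_{\mathbf{z},\sigma_o|\mathbf{y}_o}$ be the latent joint posterior on $\mathsf{Z}\times(0,\infty)$, $$p^\psi_{\mathbf{z},\sigma_o|\mathbf{y}_o}(\mathbf{z},\sigma_o)=\frac{p^\psi_{\mathbf{y}_o|\mathbf{z},\sigma_o}(\mathbf{y}_o)\,p_{\mathbf{z},\sigma_o}(\mathbf{z},\sigma_o)}{p_{\mathbf{y}_o}(\mathbf{y}_o)},\qquad p_{\mathbf{z},\sigma_o}(\mathbf{z},\sigma_o)=q_{\mathbf{z}}(\mathbf{z})\,p_{\sigma_o}(\sigma_o),$$ with likelihood $p^\psi_{\mathbf{y}_o|\mathbf{z},\sigma_o}=\mathcal{N}(\mathbf{H}_oD_o^\psi(\mathbf{z}),\sigma_o^2\mathbf{I}_o)$ and normalizing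 constant $p_{\mathbf{y}_o}(\mathbf{y}_o)$, assumed to lie in $(0,\infty)$. Let $p^\psi_{\mathbf{u}_o,\sigma_o|\mathbf{y}_o}$ be the Bayesian joint posterior on $\mathsf{U}_o\times(0,\infty)$ with prior $(D^\psi_{o\,\#}q_{\mathbf{z}})\otimes p_{\sigma_o}$ and likelihood $\mathcal{N}(\mathbf{H}_o\mathbf{u}_o,\sigma_o^2\mathbf{I}_o)$ for $\mathbf{y}_o$. Then $$p^\psi_{\mathbf{u}_o,\sigma_o|\mathbf{y}_o}=(D^\psi_o\otimes\mathrm{Id})_{\#}\,p^\psi_{\mathbf{z},\sigma_o|\mathbf{y}_o},$$ where $\mathrm{Id}$ is the identity map on $(0,\infty)$.
   Context: $(D^\psi_o\otimes\mathrm{Id})$ denotes the product map $(\mathbf{z},\sigma_o)\mapsto(D_o^\psi(\mathbf{z}),\sigma_o)$ from $\mathsf{Z}\times(0,\infty)$ to $\mathsf{U}_o\times(0,\infty)$. In the paper's setting, $D_o^\psi=D^\psi(\cdot\,;\mathsf{M}_o)$ is a graph-neural-network decoder with parameters $\psi$ conditioned on a mesh $\mathsf{M}_o$ with vertex set $\mathsf{V}_o$; for the statement it is just a fixed measurable map. $\mathbf{I}_o$ is the $d_o\times d_o$ identity matrix. For a measurable map $g$ and a measure $\mathbb{P}$, the pushforward is $(g_{\#}\mathbb{P})(A)=\mathbb{P}(g^{-1}(A))$ for measurable $A$. The letters $p,q$ denote probability measures as well as their Lebesgue densities when these exist; the asserted identity is an equality of probability measures on $\mathsf{U}_o\times(0,\infty)$.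 The Bayesian posterior for a prior probability measure $\mathbb{P}$ on a space $\mathcal{X}$ and a likelihood density $x\mapsto p(\mathbf{y}_o|x)$ is the probability measure $A\mapsto \frac{\int_A p(\mathbf{y}_o|x)\,\mathrm{d}\mathbb{P}(x)}{\int_{\mathcal{X}} p(\mathbf{y}_o|x)\,\mathrm{d}\mathbb{P}(x)}$. Here the likelihood at $(\mathbf{u},\sigma_o)$ is the (normalized) density of $\mathcal{N}(\mathbf{H}_o\mathbf{u},\sigma_o^2\mathbf{I}_o)$ at $\mathbf{y}_o$, and at $(\mathbf{z},\sigma_o)$ it is the density of $\mathcal{N}(\mathbf{H}_oD_o^\psi(\mathbf{z}),\sigma_o^2\mathbf{I}_o)$ at $\mathbf{y}_o$. *)

(* Defs.v *)
From HB Require Import structures.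
From mathcomp Require Import all_boot all_order all_algebra.
From mathcomp Require Import all_classical all_reals all_analysis.
From mathcomp Require Import measurable_realfun ring lra.

Set Implicit Arguments.
Unset Strict Implicit.
Unset Printing Implicit Defensive.

Import Order.TTheory GRing.Theory Num.Theory.
Import numFieldNormedType.Exports.

Local Open Scope classical_set_scope.
Local Open Scope ring_scope.

(* The sigma-algebra generated by a finite family of coordinate maps, as the
   library does for n.-tuple T.  For real matrices it is the Borel
   sigma-algebra (measurable_mxE below), and for {ffun V -> 'cV[R]_n} the
   finite product of Borel sigma-algebras, which is again the Borel one. *)
Definition coord_salgebra d (T : measurableType d) (X : Type) (I : finType)
    (f : I -> X -> T) : set (set X) :=
  <<s \bigcup_i preimage_set_system setT (f i) measurable >>.

Lemma measurable_coordP d d' (T : measurableType d) (Y : measurableType d')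
    (X : pointedType) (I : finType) (f : I -> X -> T) (g : Y -> X) :
  (forall A, coord_salgebra f A -> measurable (g @^-1` A)) <->
  (forall i, measurable_fun setT (f i \o g)).
Proof.
split=> [mg i _ A mA|mfg].
  rewrite setTI comp_preimage; apply: mg; apply: sub_sigma_algebra.
  by exists i => //; exists A => //; rewrite setTI.
apply: smallest_sub.
  split=> [|A mA|F mF].
  - by rewrite /= preimage_set0.
  - by rewrite /= setTD -preimage_setC; exact: measurableC.
  - by rewrite /= preimage_bigcup; exact: bigcupT_measurable.
move=> _ [i _ [A mA <-]] /=; rewrite setTI -comp_preimage.
by rewrite -[X in measurable X]setTI; exact: mfg.
Qed.

Definition measure_ffun_display : measure_display -> measure_display.
Proof. exact. Qed.

Definition measure_matrix_display : measure_display -> measure_display.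
Proof. exact. Qed.

Section measurable_ffun.
Context d (T : measurableType d) (I : finType).

HB.instance Definition _ :=
  isPointed.Build {ffun I -> T} [ffun=> point].

Let coord (i : I) (u : {ffun I -> T}) : T := u i.

HB.instance Definition _ := @isMeasurable.Build (measure_ffun_display d)
  {ffun I -> T} (coord_salgebra coord)
  (@sigma_algebra0 _ setT _) (@sigma_algebraC _ _)
  (@sigma_algebra_bigcup _ setT _).

Lemma measurable_ffunP d' (Y : measurableType d') (g : Y -> {ffun I -> T}) :
  measurable_fun setT g <-> forall i, measurable_fun setT (fun y => g y i).
Proof.
rewrite -[X in _ <-> X](measurable_coordP coord g); split=> mg A mA.
  by rewrite -[X in measurable X]setTI; exact: mg.
by move=> mB; rewrite setTI; exact: mg.
Qed.

End measurable_ffun.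

Section measurable_matrix.
Context d (T : measurableType d) (m n : nat).

Let coord (p : 'I_m * 'I_n) (M : 'M[T]_(m, n)) : T := M p.1 p.2.

HB.instance Definition _ := @isMeasurable.Build (measure_matrix_display d)
  'M[T]_(m, n) (coord_salgebra coord)
  (@sigma_algebra0 _ setT _) (@sigma_algebraC _ _)
  (@sigma_algebra_bigcup _ setT _).

Lemma measurable_matrixP d' (Y : measurableType d') (g : Y -> 'M[T]_(m, n)) :
  measurable_fun setT g <-> forall i j, measurable_fun setT (fun y => g y i j).
Proof.
apply: (@iff_trans _ (forall p, measurable_fun setT (coord p \o g))).
  rewrite -[X in _ <-> X](measurable_coordP coord g); split=> mg A mA.
    by rewrite -[X in measurable X]setTI; exact: mg.
  by move=> mB; rewrite setTI; exact: mg.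
by split=> [h i j|h [i j]]; [exact: (h (i, j))|exact: h].
Qed.

End measurable_matrix.

Lemma measurable_mxE (R : realType) (m n : nat) :
  (measurable : set (set 'M[R]_(m, n))) =
  <<s [set A : set 'M[R]_(m, n) | open A] >>.
Proof.
have mcoord i j : measurable_fun setT (fun M : 'M[R]_(m, n) => M i j).
  have /measurable_matrixP h := @measurable_id _ 'M[R]_(m, n) setT.
  exact: h.
rewrite eqEsubset; split; apply: smallest_sub; try exact: sigma_algebra_measurable;
    try exact: smallest_sigma_algebra.
  apply: bigcup_sub => -[i j] _.
  have h : measurable_fun setT
      ((fun M => M i j) : g_sigma_algebraType [set A : set 'M[R]_(m, n) | open A] -> R).
    apply: (measurability _ (RGenOpens.measurableE R)) => _ [_ [x [y ->]] <-].
    rewrite setTI; apply: sub_sigma_algebra => /=.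
    apply: open_comp; last exact: itv_open.
    by move=> M _; exact: coord_continuous.
  by move=> _ [A mA <-]; exact: h.
move=> A oA.
pose B (p : 'M[rat]_(m, n) * nat) : set 'M[R]_(m, n) :=
  [set M | forall i j, `|ratr (p.1 i j) - M i j| < p.2.+1%:R^-1].
have mB p : measurable (B p).
  have -> : B p = \bigcap_(q in [set: 'I_m * 'I_n])
      (setT `&` (fun M : 'M[R]_(m, n) => M q.1 q.2) @^-1`
        ball (ratr (p.1 q.1 q.2) : R) p.2.+1%:R^-1).
    apply/seteqP; split=> [M h [i j] _|M h i j]; last by have [] := h (i, j) I.
    by split=> //; exact: h.
  apply: fin_bigcap_measurable; first exact: finite_finset.
  by move=> [i j] _ /=; apply: mcoord => //; exact: measurable_ball.
have -> : A = \bigcup_p (if `[< B p `<=` A >] then B p else set0).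
  apply/seteqP; split=> [M AM|M [p _]]; last first.
    by case: ifPn => // /asboolP BA /BA.
  move: oA; rewrite openE => /(_ M AM) /nbhs_ballP[e /= e0 eA].
  have [k ke] : exists k : nat, k.+1%:R^-1 < e / 2.
    exists (Num.trunc (e / 2)^-1).
    by rewrite invf_plt ?posrE ?divr_gt0// truncnS_gt.
  have k0 : 0 < k.+1%:R^-1 :> R by rewrite invr_gt0.
  have /choice[f hf] (q : 'I_m * 'I_n) :
      exists r : rat, `|ratr r - M q.1 q.2| < k.+1%:R^-1.
    have [|r] := @rat_in_itvoo R (M q.1 q.2 - k.+1%:R^-1) (M q.1 q.2 + k.+1%:R^-1).
      by rewrite ltrD2l gtrN.
    by rewrite in_itv/= => h; exists r; rewrite ltr_distl.
  pose N : 'M[rat]_(m, n) := \matrix_(i, j) f (i, j).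
  exists (N, k) => //; case: ifPn => [_ i j|/asboolP[]].
    by rewrite mxE; exact: (hf (i, j)).
  move=> M' BM'; apply: eA; split=> // i j.
  have := BM' i j; have := hf (i, j); rewrite /= mxE /ball/= => h1 h2.
  rewrite (splitr e) -(subrKA (ratr (f (i, j)))) (le_lt_trans (ler_normD _ _))//.
  by rewrite ltrD// 1?distrC (lt_trans _ ke)// distrC.
apply: countable_bigcupT_measurable; first exact: countableP.
by move=> p; case: ifP.
Qed.

(* The half-line (0, +oo) with the trace of the Borel sigma-algebra. *)
Definition pos_real (R : realType) : Type := {posnum R}.

HB.instance Definition _ (R : realType) := Choice.copy (pos_real R) {posnum R}.
HB.instance Definition _ (R : realType) :=
  isPointed.Build (pos_real R) (1%:pos : {posnum R}).

Definition pos_val (R : realType) (s : pos_real R) : R :=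
  (s : {posnum R})%:num.

HB.instance Definition _ (R : realType) :=
  @isMeasurable.Build (preimage_display (@pos_val R)) (pos_real R)
    (g_sigma_algebra_preimage (@pos_val R))
    (@measurable0 _ (g_sigma_algebra_preimageType (@pos_val R)))
    (@measurableC _ (g_sigma_algebra_preimageType (@pos_val R)))
    (@bigcupT_measurable _ (g_sigma_algebra_preimageType (@pos_val R))).

Section std_gaussian.
Variable R : realType.

(* measurableTypeR R is R with the display on which normal_prob is declared. *)
Definition cons_col n (p : measurableTypeR R * 'cV[R]_n) : 'cV[R]_n.+1 :=
  col_mx (p.1%:M : 'cV_1) p.2.

Lemma cons_colE n (p : measurableTypeR R * 'cV[R]_n) i j :
  cons_col p i j = if unlift ord0 i is Some k then p.2 k 0 else p.1.
Proof.
rewrite /cons_col mxE; case: splitP => k ik.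
  rewrite !mxE ord1 (ord1 j) eqxx mulr1n.
  suff -> : i = ord0 by rewrite unlift_none.
  by apply/val_inj; rewrite /= ik (ord1 k).
suff -> : i = lift ord0 k by rewrite liftK (ord1 j).
by apply/val_inj; rewrite /= ik.
Qed.

Lemma measurable_cons_col n : measurable_fun setT (@cons_col n).
Proof.
apply/measurable_matrixP => i j.
under eq_fun do rewrite cons_colE.
case: (unlift ord0 i) => [k|]; last first.
  exact: (@measurable_fst _ _ (measurableTypeR R) 'cV[R]_n).
have /measurable_matrixP h := @measurable_snd _ _ (measurableTypeR R) 'cV[R]_n.
exact: h.
Qed.

HB.instance Definition _ n := isMeasurableFun.Build _ _ _ _
  (@cons_col n) (@measurable_cons_col n).

(* N(0, I_n), the law of n independent N(0, 1) coordinates. *)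
Fixpoint std_gaussian (n : nat) : probability 'cV[R]_n R :=
  match n with
  | 0 => dirac (0 : 'cV[R]_0)
  | n.+1 => distribution (normal_prob (0 : R) 1 \x std_gaussian n)%E
      (@cons_col n : {mfun (measurableTypeR R * 'cV[R]_n)%type >-> 'cV[R]_n.+1})
  end.

End std_gaussian.

Lemma std_gaussian_box (R : realType) n (A : 'I_n -> set R) :
  (forall i, measurable (A i)) ->
  std_gaussian R n [set z | forall i, A i (z i 0)] =
  (\prod_(i < n) normal_prob (0 : R) 1 (A i))%E.
Proof.
elim: n A => [|n IH] A mA.
  rewrite big_ord0 /= diracE mem_set//= => -[].
  by case.
rewrite big_ord_recl -IH //=.
rewrite /distribution /pushforward /=.
have -> : @cons_col R n @^-1` [set z | forall i, A i (z i 0)] =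
    A ord0 `*` [set z : 'cV[R]_n | forall i, A (lift ord0 i) (z i 0)].
  apply/seteqP; split=> [p /= h|p [/= h1 h2] i].
    split=> [|i] /=; first by have := h ord0; rewrite cons_colE unlift_none.
    by have := h (lift ord0 i); rewrite cons_colE liftK.
  by rewrite cons_colE; case: unliftP => [k ->|->].
have mB : measurable [set z : 'cV[R]_n | forall i, A (lift ord0 i) (z i 0)].
  have -> : [set z : 'cV[R]_n | forall i, A (lift ord0 i) (z i 0)] =
      \bigcap_(i in [set: 'I_n])
        (setT `&` (fun z : 'cV[R]_n => z i 0) @^-1` A (lift ord0 i)).
    apply/seteqP; split=> [z h i _|z h i]; last by have [] := h i I.
    by split=> //; exact: h.
  apply: fin_bigcap_measurable; first exact: finite_finset.
  move=> i _; have /measurable_matrixP h := @measurable_id _ 'cV[R]_n setT.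
  by apply: h => //; exact: mA.
by rewrite product_measure1E//; exact: mA.
Qed.

(* Density at y of the multivariate normal distribution N(m, S), for S
   symmetric positive definite. *)
Definition mvnormal_pdf (R : realType) (n : nat) (m : 'cV[R]_n) (S : 'M[R]_n)
    (y : 'cV[R]_n) : R :=
  (Num.sqrt ((2 * pi) ^+ n * \det S))^-1 *
  expR (- ((y - m)^T *m invmx S *m (y - m)) 0 0 / 2).

Lemma mvnormal_pdf_scalar (R : realType) (n : nat) (m y : 'cV[R]_n) (s : R) :
  0 < s ->
  mvnormal_pdf m (s ^+ 2)%:M y = \prod_(i < n) normal_pdf (m i 0) s (y i 0).
Proof.
move=> s0; under eq_bigr do rewrite normal_pdfE ?gt_eqF//.
rewrite big_split/= -expR_sum prodr_const card_ord /mvnormal_pdf; congr (_ * _).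
  rewrite /normal_peak exprVn det_scalar -exprMn; congr (_^-1).
  rewrite (_ : 2 * pi * s ^+ 2 = s ^+ 2 * pi *+ 2); last by ring.
  set a := s ^+ 2 * pi *+ 2.
  have a0 : 0 <= a by rewrite mulrn_wge0// mulr_ge0// ?sqr_ge0// pi_ge0.
  rewrite -{1}(sqr_sqrtr a0) -exprM mulnC exprM sqrtr_sqr.
  by rewrite ger0_norm// exprn_ge0.
congr expR; rewrite invmx_scalar mul_mx_scalar -scalemxAl !mxE.
rewrite mulr_sumr mulNr mulr_suml -sumrN; apply: eq_bigr => i _.
rewrite !mxE; field; lra.
Qed.

(* The quotient is meaningful when the denominator lies in (0, +oo). *)
Definition bayes_posterior d (X : measurableType d) (R : realType)
    (P : probability X R) (L : X -> R) (A : set X) : \bar R :=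
  ((\int[P]_(x in A) (L x)%:E) / (\int[P]_x (L x)%:E))%E.

(* H is given by the matrix of zeros and ones whose k-th row, indexed by the
   pairs (vertex, component), has its only 1 at the k-th observed value. *)
Definition selection_operator (R : realType) (V : finType) (du n : nat)
    (H : {ffun V -> 'cV[R]_du} -> 'cV[R]_n) : Prop :=
  exists sel : 'I_n -> V * 'I_du, forall u k,
    H u k 0 = \sum_(p : V * 'I_du) (p == sel k)%:R * u p.1 p.2 0.

Definition likelihood (R : realType) (V : finType) (du n : nat)
    (H : {ffun V -> 'cV[R]_du} -> 'cV[R]_n) (y : 'cV[R]_n)
    (x : {ffun V -> 'cV[R]_du} * pos_real R) : R :=
  mvnormal_pdf (H x.1) (pos_val x.2 ^+ 2)%:M y.

Definition latent_likelihood (R : realType) (V : finType) (du dz n : nat)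
    (H : {ffun V -> 'cV[R]_du} -> 'cV[R]_n)
    (D : 'cV[R]_dz -> {ffun V -> 'cV[R]_du}) (y : 'cV[R]_n)
    (x : 'cV[R]_dz * pos_real R) : R :=
  mvnormal_pdf (H (D x.1)) (pos_val x.2 ^+ 2)%:M y.

(* Main.v *)
Require Import Defs.
From HB Require Import structures.
From mathcomp Require Import all_boot all_order all_algebra.
From mathcomp Require Import all_classical all_reals all_analysis.
From mathcomp Require Import measurable_realfun.

Set Implicit Arguments.
Unset Strict Implicit.
Unset Printing Implicit Defensive.

Import Order.TTheory GRing.Theory Num.Theory.
Import numFieldNormedType.Exports.

Local Open Scope classical_set_scope.
Local Open Scope ring_scope.

(* The latent likelihood is the likelihood composed with T = D x Id, and the
   prior on U_o x (0, +oo) is the pushforward under T of the latent prior: both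
   are product measures agreeing on rectangles. Since the likelihood is
   nonnegative and measurable, the change-of-variables formula identifies the
   numerators and the normalizing constants of the two posteriors. *)

(** On nonnegative reals inversion is the power function with exponent [-1], which is measurable on
    the whole line. The value [0] is covered, since both sides are then [0]. *)
Lemma measurable_fun_inv_ge0 d (T : measurableType d) (R : realType)
    (f : T -> R) :
  (forall x, 0 <= f x) -> measurable_fun setT f ->
  measurable_fun setT (fun x => (f x)^-1).
Proof.
move=> f0 mf; under eq_fun do rewrite -powR_inv1//.
exact: (measurableT_comp (measurable_powR (-1)) mf).
Qed.

(** Here the observation [y] is fixed while mean and standard deviation vary, as a likelihood
    requires. Since [s x] is nonzero, the density is given by its closed formula, a composition of
    measurable operations. *)
Lemma measurable_normal_pdf_param d (T : measurableType d) (R : realType)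
    (m s : T -> R) (y : R) :
  (forall x, 0 < s x) -> measurable_fun setT m -> measurable_fun setT s ->
  measurable_fun setT (fun x => normal_pdf (m x) (s x) y).
Proof.
move=> s0 mm ms; under eq_fun do rewrite normal_pdfE ?gt_eqF//.
have ms2 : measurable_fun setT (fun x => s x ^+ 2) by exact: measurable_funX.
apply: measurable_funM.
  apply: measurable_fun_inv_ge0 => [x|]; first exact: sqrtr_ge0.
  apply: measurableT_comp.
    exact: continuous_measurable_fun (@sqrt_continuous R).
  under eq_fun do rewrite -mulr_natr; apply: measurable_funM => //.
  exact: measurable_funM.
apply: measurableT_comp => //; apply: measurable_funM.
  apply: measurableT_comp => //; apply: measurable_funX.
  exact: measurable_funB.
apply: measurable_fun_inv_ge0 => [x|]; first by rewrite mulrn_wge0// sqr_ge0.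
by under eq_fun do rewrite -mulr_natr; exact: measurable_funM.
Qed.

Lemma mvnormal_pdf_ge0 (R : realType) (n : nat) (m : 'cV[R]_n) (S : 'M[R]_n)
    (y : 'cV[R]_n) : 0 <= mvnormal_pdf m S y.
Proof. by rewrite mulr_ge0 ?expR_ge0// invr_ge0 sqrtr_ge0. Qed.

Lemma pos_val_gt0 (R : realType) (s : pos_real R) : 0 < pos_val s.
Proof. exact: (@gt0 _ _ (s : {posnum R})). Qed.

Lemma measurable_pos_val (R : realType) :
  measurable_fun setT (@pos_val R).
Proof. by move=> _ A mA; exists A => //; rewrite setTI. Qed.

Lemma measurable_selection_operator (R : realType) (V : finType) (du n : nat)
    (H : {ffun V -> 'cV[R]_du} -> 'cV[R]_n) :
  selection_operator H -> measurable_fun setT H.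
Proof.
move=> [sel HE]; apply/measurable_matrixP => i j; rewrite (ord1 j).
under eq_fun do rewrite HE.
apply: measurable_sum => p; apply: measurable_funM => //.
have /measurable_ffunP/(_ p.1) := @measurable_id _ {ffun V -> 'cV[R]_du} setT.
by move=> /measurable_matrixP/(_ p.2 0).
Qed.

(** The covariance is a positive multiple of the identity, so the density factors over coordinates
    into finitely many one-dimensional normal densities, each measurable in its parameters. *)
Lemma measurable_likelihood (R : realType) (V : finType) (du n : nat)
    (H : {ffun V -> 'cV[R]_du} -> 'cV[R]_n) (y : 'cV[R]_n) :
  measurable_fun setT H -> measurable_fun setT (likelihood H y).
Proof.
move=> mH.
have -> : likelihood H y =
    fun x => \prod_(i < n) normal_pdf (H x.1 i 0) (pos_val x.2) (y i 0).
  by apply/funext => x; exact/mvnormal_pdf_scalar/pos_val_gt0.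
apply: measurable_prod => i _; apply: measurable_normal_pdf_param.
- by move=> x; exact: pos_val_gt0.
- move: mH => /measurable_matrixP/(_ i 0) mH.
  exact: (measurableT_comp mH measurable_fst).
- exact: (measurableT_comp (@measurable_pos_val R) measurable_snd).
Qed.

Section product_pushforward.
Context d1 d2 d3 (X : measurableType d1) (Y : measurableType d2)
  (Z : measurableType d3) (R : realType).
Variables (P : probability X R) (Q : probability Z R) (f : {mfun X >-> Y}).

(** This map is named in order to be bundled as a measurable function: its [distribution] is then a
    measure, which can be compared with the product measure. *)
Let prod_id (x : X * Z) : Y * Z := (f x.1, x.2).

Let measurable_prod_id : measurable_fun setT prod_id.
Proof.
apply: measurable_fun_pair; last exact: measurable_snd.
exact: (measurableT_comp (measurable_funPT f) measurable_fst).
Qed.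

HB.instance Definition _ :=
  isMeasurableFun.Build _ _ _ _ prod_id measurable_prod_id.

(** A product measure is determined by its values on rectangles, and the preimage of [B]*[C] is the
    rectangle [(f @^-1] B) [*] C[, of mass]P (f @^-1[B) * Q C]. *)
Lemma distribution_product (A : set (Y * Z)) : measurable A ->
  (distribution P f \x Q)%E A =
  pushforward (P \x Q)%E (fun x : X * Z => (f x.1, x.2)) A.
Proof.
apply: (@product_measure_unique _ _ _ _ _ _ _
  (distribution (P \x Q)%E (prod_id : {mfun _ >-> _}))) => B C mB mC.
rewrite /distribution /pushforward /=.
have -> : prod_id @^-1` (B `*` C) = (f @^-1` B) `*` C by [].
rewrite product_measure1E//.
by rewrite -[X in measurable X]setTI; exact: measurable_funPT.
Qed.

Lemma ge0_integral_distribution_product (A : set (Y * Z))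
    (g : Y * Z -> \bar R) :
  measurable A -> measurable_fun setT g -> (forall x, 0 <= g x)%E ->
  (\int[distribution P f \x Q]_(x in A) g x =
   \int[P \x Q]_(x in (fun x => (f x.1, x.2)) @^-1` A) g (f x.1, x.2))%E.
Proof.
move=> mA mg g0.
(* The integral over [A] depends only on the values of the measure on measurable subsets of [A], so
   the product may be replaced by the pushforward. *)
rewrite (eq_measure_integral
  (distribution (P \x Q)%E (prod_id : {mfun _ >-> _}))).
  by rewrite ge0_integral_pushforward//; exact: measurable_funTS.
by move=> B mB _; exact: distribution_product.
Qed.

End product_pushforward.

Theorem corollary2p3 (R : realType) (V_o : finType) (d_u d_z d_o : nat)
    (D : {mfun 'cV[R]_d_z >-> {ffun V_o -> 'cV[R]_d_u}})
    (p_sigma : probability (pos_real R) R)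
    (H : {linear {ffun V_o -> 'cV[R]_d_u} -> 'cV[R]_d_o})
    (y : 'cV[R]_d_o) :
  let q_z := std_gaussian R d_z in
  let lik_z := latent_likelihood H D y in
  let lik_u := likelihood H y in
  let posterior_z := bayes_posterior (q_z \x p_sigma)%E lik_z in
  let posterior_u :=
    bayes_posterior (distribution q_z D \x p_sigma)%E lik_u in
  selection_operator H ->
  (0 < \int[(q_z \x p_sigma)]_x (lik_z x)%:E < +oo)%E ->
  forall A : set ({ffun V_o -> 'cV[R]_d_u} * pos_real R), measurable A ->
    posterior_u A = pushforward posterior_z (fun x => (D x.1, x.2)) A.
Proof.
move=> q_z lik_z lik_u posterior_z posterior_u selH _ A mA.
have mlik : measurable_fun setT (fun x => (lik_u x)%:E).
  apply/measurable_EFinP; apply: measurable_likelihood.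
  exact: measurable_selection_operator.
have lik0 x : (0 <= (lik_u x)%:E)%E by rewrite lee_fin mvnormal_pdf_ge0.
(* Stated for every measurable [B] so as to serve twice: [B = A] gives the numerators, [B = setT]
   the normalizing constants. *)
have E B : measurable B ->
    (\int[distribution q_z D \x p_sigma]_(x in B) (lik_u x)%:E =
    \int[q_z \x p_sigma]_(x in (fun x => (D x.1, x.2)) @^-1` B) (lik_z x)%:E)%E.
  move=> mB.
  (* By unfolding, [lik_z x] is [lik_u (D x.1, x.2)]. *)
  exact: (ge0_integral_distribution_product q_z p_sigma D mB mlik lik0).
rewrite /posterior_u /bayes_posterior (E A mA) (E setT measurableT).
by rewrite preimage_setT.
Qed.
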